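(* Let $\mathcal{A}\in\{0,\ast,?\}^{n\times n}$, $\mathcal{L}\in\{0,\ast,?\}^{n\times q}$, $\mathcal{C}\in\{0,\ast,?\}^{p\times n}$ be pattern matrices, and let $\mathcal{L}_i$ denote the $i$th column of $\mathcal{L}$. Suppose that the FDI problem for $(\mathcal{A},\mathcal{L},\mathcal{C})$ is solvable. Then the index $\eta_i$ of $(\mathcal{A},\mathcal{L}_i,\mathcal{C})$ exists for all $i=1,2,\ldots,q$.
   Context: A pattern matrix is a matrix with entries in the set of symbols $\{0,\ast,?\}$. The pattern class of $\mathcal{M}\in\{0,\ast,?\}^{r\times s}$ is $\mathcal{P}(\mathcal{M}):=\{M\in\mathbb{R}^{r\times s} \mid M_{ij}=0 \text{ if } \mathcal{M}_{ij}=0,\ M_{ij}\neq 0\text{ if }\mathcal{M}_{ij}=\ast\}$ (entries at positions with $?$ are arbitrary reals). The linear structured system $(\mathcal{A},\mathcal{L},\mathcal{C})$ is the family of systems $(A,L,C)$ (that is, $\dot x=Ax+Lf$, $y=Cx$) with $A\in\mathcal{P}(\mathcal{A})$, $L\in\mathcal{P}(\mathcal{L})$, $C\in\mathcal{P}(\mathcal{C})$; one writes $(A,L,C)\in(\mathcal{A},\mathcal{L},\mathcal{C})$. Solvability for a real system: for $A\in\mathbb{R}^{n\times n}$, $L\in\mathbb{R}^{n\times q}$ with columns $L_i$, $C\in\mathbb{R}^{p\times n}$, and $G\in\mathbb{R}^{n\times p}$, let $\mathcal{V}_i$ be the smallest $(A+GC)$-invariant subspace of $\mathbb{R}^n$ containing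 $\operatorname{im}L_i$. The FDI (fault detection and isolation) problem for $(A,L,C)$ is solvable if there exists $G\in\mathbb{R}^{n\times p}$ such that the family $\{C\mathcal{V}_i\}_{i=1}^q$ is independent, meaning that $C\mathcal{V}_i\neq\{0\}$ and $C\mathcal{V}_i\cap\big(\sum_{j\neq i}C\mathcal{V}_j\big)=\{0\}$ for all $i=1,\ldots,q$. The FDI problem for $(\mathcal{A},\mathcal{L},\mathcal{C})$ is solvable if it is solvable for every $(A,L,C)\in(\mathcal{A},\mathcal{L},\mathcal{C})$. Operations on $\{0,\ast,?\}$ (both commutative): $0+x=x$ for all $x$; $\ast+\ast=?$, $\ast+?=?$, $?+?=?$; $0\cdot x=0$ for all $x$; $\ast\cdot\ast=\ast$, $\ast\cdot ?=?$, $?\cdot ?=?$. For $\mathcal{M}\in\{0,\ast,?\}^{r\times s}$, $\mathcal{N}\in\{0,\ast,?\}^{s\times t}$, the product is $(\mathcal{M}\mathcal{N})_{ij}:=\sum_{k=1}^{s}\mathcal{M}_{ik}\cdot\mathcal{N}_{kj}$. For square $\mathcal{M}$, $\mathcal{M}^0=\mathcal{I}$ (the pattern matrix with $\ast$ on the diagonal and $0$ elsewhere) and $\mathcal{M}^k=\mathcal{M}^{k-1}\mathcal{M}$. $\mathcal{O}$ denotes a pattern matrix with all entries $0$. Index: the index of $(\mathcal{A},\mathcal{L}_i,\mathcal{C})$ is the positive integer $\eta_i$ (if it exists) such that $\mathcal{C}\mathcal{A}^j\mathcal{L}_i=\mathcal{O}$ for $j=0,1,\ldots,\eta_i-2$ and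 $\mathcal{C}\mathcal{A}^{\eta_i-1}\mathcal{L}_i\neq\mathcal{O}$. If no such positive integer exists, the index is said not to exist. *)

(* Defs.v *)
From HB Require Import structures.
From mathcomp Require Export all_boot all_order all_algebra.
From mathcomp Require Export reals.

Set Implicit Arguments.
Unset Strict Implicit.
Unset Printing Implicit Defensive.

Import GRing.Theory.

Local Open Scope ring_scope.

Inductive symbol := SZero | SStar | SAny.

Definition symbol_code (x : symbol) : 'I_3 :=
  match x with SZero => inord 0 | SStar => inord 1 | SAny => inord 2 end.

Definition symbol_decode (i : 'I_3) : symbol :=
  match nat_of_ord i with 0 => SZero | 1 => SStar | _ => SAny end.

Lemma symbol_codeK : cancel symbol_code symbol_decode.
Proof. by case; rewrite /symbol_decode /= inordK. Qed.

HB.instance Definition _ := Countable.copy symbol (can_type symbol_codeK).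

Definition symbol_add (x y : symbol) : symbol :=
  match x, y with
  | SZero, z | z, SZero => z
  | _, _ => SAny
  end.

Definition symbol_mul (x y : symbol) : symbol :=
  match x, y with
  | SZero, _ | _, SZero => SZero
  | SStar, SStar => SStar
  | _, _ => SAny
  end.

Lemma symbol_addA : associative symbol_add. Proof. by do 3 case. Qed.
Lemma symbol_addC : commutative symbol_add. Proof. by do 2 case. Qed.
Lemma symbol_add0 : left_id SZero symbol_add. Proof. by case. Qed.
Lemma symbol_mulA : associative symbol_mul. Proof. by do 3 case. Qed.
Lemma symbol_mulC : commutative symbol_mul. Proof. by do 2 case. Qed.
Lemma symbol_mul1 : left_id SStar symbol_mul. Proof. by case. Qed.
Lemma symbol_mulD : left_distributive symbol_mul symbol_add.
Proof. by do 3 case. Qed.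
Lemma symbol_mul0 : left_zero SZero symbol_mul. Proof. by []. Qed.
Lemma symbol_1neq0 : SStar != SZero. Proof. by apply/eqP. Qed.

(* With these operations {0, *, ?} is a commutative semiring whose 0 is SZero
   and whose 1 is SStar.  Hence, for pattern matrices, [*m] is the entrywise
   sum of products of symbols, [1%:M] has * on the diagonal and 0 elsewhere,
   and [^+] is the iterated product. *)
HB.instance Definition _ :=
  GRing.isNmodule.Build symbol symbol_addA symbol_addC symbol_add0.
HB.instance Definition _ :=
  GRing.Nmodule_isComNzSemiRing.Build symbol
    symbol_mulA symbol_mulC symbol_mul1 symbol_mulD symbol_mul0 symbol_1neq0.

Definition pattern_class (R : realType) (r s : nat) (P : 'M[symbol]_(r, s))
    (M : 'M[R]_(r, s)) : Prop :=
  forall i j, (P i j = SZero -> M i j = 0) /\ (P i j = SStar -> M i j <> 0).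

(* The map x |-> M x on column vectors. *)
Definition mxhom (R : realType) (m n : nat) (M : 'M[R]_(m, n)) :
    'Hom('cV[R]_n, 'cV[R]_m) :=
  linfun (mulmx M).

Definition invariant_subspace (R : realType) (n : nat) (M : 'M[R]_n)
    (V : {vspace 'cV[R]_n}) : Prop :=
  (mxhom M @: V <= V)%VS.

Definition smallest_invariant (R : realType) (n : nat) (M : 'M[R]_n)
    (W V : {vspace 'cV[R]_n}) : Prop :=
  [/\ invariant_subspace M V, (W <= V)%VS &
      forall U : {vspace 'cV[R]_n}, invariant_subspace M U -> (W <= U)%VS -> (V <= U)%VS].

Definition independent_subspaces (R : realType) (p q : nat)
    (U : 'I_q -> {vspace 'cV[R]_p}) : Prop :=
  forall i, U i <> 0%VS /\ (U i :&: \sum_(j | j != i) U j)%VS = 0%VS.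

(* For each G the family V exists and is unique, so quantifying V existentially
   only names the subspaces generated by G. *)
Definition FDI_solvable_real (R : realType) (n q p : nat)
    (A : 'M[R]_n) (L : 'M[R]_(n, q)) (C : 'M[R]_(p, n)) : Prop :=
  exists (G : 'M[R]_(n, p)) (V : 'I_q -> {vspace 'cV[R]_n}),
    (forall i, smallest_invariant (A + G *m C) (limg (mxhom (col i L))) (V i)) /\
    independent_subspaces (fun i => (mxhom C @: V i)%VS).

Definition FDI_solvable (R : realType) (n q p : nat)
    (A : 'M[symbol]_n) (L : 'M[symbol]_(n, q)) (C : 'M[symbol]_(p, n)) : Prop :=
  forall (A' : 'M[R]_n) (L' : 'M[R]_(n, q)) (C' : 'M[R]_(p, n)),
    pattern_class A A' -> pattern_class L L' -> pattern_class C C' ->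
    FDI_solvable_real A' L' C'.

Definition is_index (n p : nat) (A : 'M[symbol]_n) (l : 'cV[symbol]_n)
    (C : 'M[symbol]_(p, n)) (eta : nat) : Prop :=
  [/\ (0 < eta)%N,
      forall j : nat, (j.+1 < eta)%N -> C *m A ^+ j *m l = 0 &
      C *m A ^+ eta.-1 *m l <> 0].

(* Main.v *)
(** If the index of [(A, L_i, C)] does not exist, then every pattern
    [C A^k L_i] vanishes.  Let [S] be the set of states reached by some pattern
    [A^k L_i].  In any realization the coordinate subspace supported on [S]
    contains [im L_i], is [A]-invariant, and lies in the kernel of [C], since no
    cancellation occurs in the symbol semiring.  It is therefore
    [(A + G C)]-invariant for every [G], so [C V_i = 0], which solvability
    forbids. *)
Require Import Defs.
From mathcomp Require Import boolp.

Set Implicit Arguments.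
Unset Strict Implicit.
Unset Printing Implicit Defensive.

Import GRing.Theory.

Local Open Scope ring_scope.

Lemma symbol_addr_eq0l (x y : symbol) : x + y = 0 -> x = 0.
Proof. by case: x; case: y. Qed.

Lemma symbol_mulf_neq0 (x y : symbol) : x != 0 -> y != 0 -> x * y != 0.
Proof.
by move=> /eqP x0 /eqP y0; apply/eqP; case: x x0 => // _; case: y y0.
Qed.

Lemma symbol_sumr_eq0 (I : finType) (F : I -> symbol) :
  \sum_i F i = 0 -> forall i, F i = 0.
Proof. by move=> F0 i; move: F0; rewrite (bigD1 i) //=; apply: symbol_addr_eq0l. Qed.

(** One nonzero term keeps the whole entry nonzero: symbols have no zero divisors, and a sum of
    symbols vanishes only if every term does. *)
Lemma pattern_mulmx_neq0 (r s t : nat) (M : 'M[symbol]_(r, s))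
    (N : 'M[symbol]_(s, t)) i k j :
  M i k != 0 -> N k j != 0 -> (M *m N) i j != 0.
Proof.
move=> Mik Nkj; apply/eqP; rewrite mxE => /symbol_sumr_eq0/(_ k)/eqP.
by rewrite (negbTE (symbol_mulf_neq0 Mik Nkj)).
Qed.

(** A witness that every pattern class is inhabited, so that solvability can be instantiated; each
    [SAny] entry is realized by 1. *)
Definition pattern_realization (R : realType) (r s : nat)
    (P : 'M[symbol]_(r, s)) : 'M[R]_(r, s) :=
  \matrix_(i, j) (P i j != 0)%:R.

Lemma pattern_class_realization (R : realType) (r s : nat)
    (P : 'M[symbol]_(r, s)) : pattern_class P (pattern_realization R P).
Proof.
move=> i j; rewrite mxE; split=> ->; first by rewrite eqxx.
by rewrite symbol_1neq0; apply/eqP/oner_neq0.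
Qed.

Lemma mxhomE (R : realType) (m n : nat) (M : 'M[R]_(m, n)) x :
  mxhom M x = M *m x.
Proof. by rewrite lfunE. Qed.

(** Encoded as the kernel of the projection onto the coordinates outside [S], which makes it a
    [{vspace}] at once. *)
Definition coord_subspace (R : realType) (n : nat) (S : pred 'I_n) :
    {vspace 'cV[R]_n} :=
  lker (mxhom (diag_mx (\row_k (~~ S k)%:R))).

Lemma mem_coord_subspace (R : realType) (n : nat) (S : pred 'I_n)
    (x : 'cV[R]_n) :
  reflect (forall k, ~~ S k -> x k 0 = 0) (x \in coord_subspace R S).
Proof.
rewrite memv_ker mxhomE; apply: (iffP eqP) => [x0 k Sk|x0].
  by have /matrixP/(_ k 0) := x0; rewrite mul_diag_mx !mxE Sk mul1r.
apply/matrixP=> k j; rewrite mul_diag_mx !mxE ord1.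
by case: (boolP (S k)) => [|/x0 ->]; rewrite ?mul0r ?mulr0.
Qed.

(** In a row outside [T] each term of the product vanishes: [x] is zero off [S], and on [S] the
    pattern forces the entry of [M] to be zero. *)
Lemma pattern_mulmx_coord_subspace (R : realType) (r s : nat)
    (P : 'M[symbol]_(r, s)) (M : 'M[R]_(r, s)) (S : pred 'I_s) (T : pred 'I_r) x :
  pattern_class P M -> (forall i k, S k -> P i k != 0 -> T i) ->
  x \in coord_subspace R S -> M *m x \in coord_subspace R T.
Proof.
move=> PM ST /mem_coord_subspace x0; apply/mem_coord_subspace=> i Ti.
rewrite mxE big1 // => k _; case: (boolP (S k)) => [Sk|/x0 ->]; last exact: mulr0.
have [Pik|/(ST _ _ Sk)] := eqVneq (P i k) 0; last by rewrite (negbTE Ti).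
by rewrite (PM i k).1 ?mul0r.
Qed.

Lemma coord_subspace0 (R : realType) (n : nat) (x : 'cV[R]_n) :
  x \in coord_subspace R pred0 -> x = 0.
Proof.
by move=> /mem_coord_subspace x0; apply/matrixP=> k j; rewrite ord1 mxE x0.
Qed.

Lemma FDI_solvable_real_markov_neq0 (R : realType) (n q p : nat)
    (A : 'M[symbol]_n) (L : 'M[symbol]_(n, q)) (C : 'M[symbol]_(p, n))
    (A' : 'M[R]_n) (L' : 'M[R]_(n, q)) (C' : 'M[R]_(p, n)) (i : 'I_q) :
  pattern_class A A' -> pattern_class L L' -> pattern_class C C' ->
  FDI_solvable_real A' L' C' ->
  exists j, C *m A ^+ j *m col i L != 0.
Proof.
move=> PA PL PC [G [V [Vmin Vindep]]]; apply: contrapT => /forallNP CAL0.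
pose S := [pred k | `[< exists j, (A ^+ j *m col i L) k 0 != 0 >]].
pose U := coord_subspace R S.
have UC x : x \in U -> C' *m x = 0.
  (* With [T := pred0], it remains to refute a nonzero [C a k] with [k] in [S]: it would make some
     pattern [C A^j L_i] nonzero. *)
  move=> Ux; apply/coord_subspace0/(pattern_mulmx_coord_subspace PC _ Ux).
  move=> a k /asboolP[j Sk] Cak; case: (CAL0 j); apply/eqP.
  move=> /matrixP/(_ a 0); rewrite [RHS]mxE -mulmxA; apply/eqP.
  exact: pattern_mulmx_neq0 Cak Sk.
have UA x : x \in U -> A' *m x \in U.
  apply: pattern_mulmx_coord_subspace => // a k /asboolP[j Sk] Aak.
  apply/asboolP; exists j.+1.
  by rewrite exprS -[_ * _]/(_ *m _) -mulmxA (pattern_mulmx_neq0 Aak Sk).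
have [_ _ Vleast] := Vmin i.
have VU : (V i <= U)%VS.
  apply: Vleast.
    apply/subvP=> _ /memv_imgP[x Ux ->].
    by rewrite mxhomE mulmxDl -mulmxA UC // mulmx0 addr0 UA.
  apply/subvP=> _ /memv_imgP[x _ ->]; rewrite mxhomE.
  apply/mem_coord_subspace=> k Sk; rewrite mxE big1 // => j _.
  rewrite mxE (PL k i).1 ?mul0r //; apply/eqP; apply: contraNT Sk => Lki.
  (* The exponent 0 puts the support of [L_i] itself into [S]. *)
  by apply/asboolP; exists 0; rewrite expr0 mul1mx mxE.
apply: (Vindep i).1; apply/eqP; rewrite -subv0.
apply/subvP=> _ /memv_imgP[x Vx ->].
by rewrite mxhomE UC ?mem0v // (subvP VU).
Qed.

Theorem theorem5 (R : realType) (n q p : nat)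
    (A : 'M[symbol]_n) (L : 'M[symbol]_(n, q)) (C : 'M[symbol]_(p, n))
    (Hsolv : FDI_solvable R A L C) :
  forall i : 'I_q, exists eta : nat, is_index A (col i L) C eta.
Proof.
move=> i; have PA := pattern_class_realization R A.
have PL := pattern_class_realization R L.
have PC := pattern_class_realization R C.
have ex_markov :=
  FDI_solvable_real_markov_neq0 i PA PL PC (Hsolv _ _ _ PA PL PC).
(* The index is one more than the least exponent [m] with [C A^m L_i] nonzero. *)
case: (ex_minnP ex_markov) => m CAL_neq0 m_min; exists m.+1; split=> //.
  move=> j; rewrite ltnS => lt_jm; apply/eqP; apply: contraLR lt_jm.
  by rewrite -leqNgt; apply: m_min.
exact/eqP.
Qed.
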